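(* Let $(A,V)$ and $(B,W)$ be permutation groups on finite sets, neither equal to $I_1$, with $A\notin DGR$ and $B$ arbitrary. Then $A\times B\notin DGR$.
   Context: A permutation group $(A,V)$ is a group $A$ of permutations of a set $V$; $I_n$ denotes the trivial group acting on an $n$-element set; groups are considered up to permutation isomorphism. The direct product $A\times B$ acts on $V\times W$ by $(a,b)(x,y)=(a(x),b(y))$. An edge-colored digraph on a set $U$ is a function $E$ from the set of ordered pairs $(u,u')$ of distinct elements of $U$ to a finite set of colors; its automorphisms are the permutations $\sigma$ of $U$ with $E((\sigma(u),\sigma(u')))=E((u,u'))$ for all distinct $u,u'$. $DGR$ is the class of permutation groups that equal the full automorphism group of some edge-colored digraph on their underlying set. *)

(* Defs.v *)
From HB Require Import structures.
From mathcomp Require Import all_boot all_fingroup.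

Set Implicit Arguments.
Unset Strict Implicit.
Unset Printing Implicit Defensive.

(* A permutation group (A, V) on a finite set is V : finType together with
   A : {group {perm V}}. *)

Section TrivialPermGroup.
Variable V : finType.

(* (A, V) is, up to permutation isomorphism, the group I_n. *)
Definition is_trivial_perm_group (n : nat) (A : {group {perm V}}) : Prop :=
  #|V| = n /\ A :=: 1%g.

End TrivialPermGroup.

Section DirectProduct.
Variables V W : finType.
Implicit Types (a : {perm V}) (b : {perm W}).

Definition prod_act a b (p : V * W) : V * W := (a p.1, b p.2).

Lemma prod_act_inj a b : injective (prod_act a b).
Proof. by move=> [x y] [x' y'] [/perm_inj-> /perm_inj->]. Qed.

Definition prod_perm a b : {perm V * W} := perm (@prod_act_inj a b).

Variables (A : {group {perm V}}) (B : {group {perm W}}).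

Definition prod_perm_set : {set {perm V * W}} :=
  [set prod_perm a b | a in A, b in B].

Lemma prod_perm_group_set : group_set prod_perm_set.
Proof.
apply/group_setP; split.
  apply/imset2P; exists 1%g 1%g; rewrite ?group1 //.
  by apply/permP=> -[x y]; rewrite !permE /prod_act !permE.
move=> _ _ /imset2P[a b Aa Bb ->] /imset2P[a' b' Aa' Bb' ->].
apply/imset2P; exists (a * a')%g (b * b')%g; rewrite ?groupM //.
by apply/permP=> -[x y]; rewrite !permE /prod_act /= !permE.
Qed.

Canonical prod_perm_group : {group {perm V * W}} := Group prod_perm_group_set.

End DirectProduct.

Section EdgeColoredDigraph.
Variable U : finType.

Definition arc : finType := {p : U * U | p.1 != p.2}.

Lemma arc_perm_subproof (s : {perm U}) (e : arc) :
  s (val e).1 != s (val e).2.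
Proof. by rewrite (inj_eq perm_inj) (valP e). Qed.

Definition arc_perm (s : {perm U}) (e : arc) : arc :=
  exist (fun p : U * U => p.1 != p.2) (s (val e).1, s (val e).2)
    (arc_perm_subproof s e).

Definition colored_digraph (C : finType) := arc -> C.

Variables (C : finType) (E : colored_digraph C).

Definition digraph_aut_set : {set {perm U}} :=
  [set s | [forall e : arc, E (arc_perm s e) == E e]].

Lemma digraph_aut_group_set : group_set digraph_aut_set.
Proof.
apply/group_setP; split.
  rewrite inE; apply/forallP=> e; apply/eqP; congr E; apply/val_inj.
  by rewrite /= !perm1 -surjective_pairing.
move=> s t; rewrite !inE => /forallP sE /forallP tE.
apply/forallP=> e; rewrite -(eqP (sE e)) -(eqP (tE (arc_perm s e))).
by apply/eqP; congr E; apply/val_inj; rewrite /= !permM.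
Qed.

Canonical digraph_aut_group : {group {perm U}} := Group digraph_aut_group_set.

End EdgeColoredDigraph.

Definition DGR (U : finType) (A : {group {perm U}}) : Prop :=
  exists (C : finType) (E : colored_digraph U C), A :=: digraph_aut_group E.

(* Main.v *)
Require Import Defs.
From mathcomp Require Import all_boot all_fingroup.

(** A permutation group is in DGR iff it contains every permutation [s] that
    agrees with some group element on each pair of distinct points (color the
    arcs by their orbits).  If [s] is such a permutation for [A], then
    [prod_perm s 1] is one for [A x B]: two points of [V * W] involve at most two
    points of [V], and two equal ones are handled by adding any other point
    of [V]. *)

Section TwoClosed.
Variable U : finType.
Implicit Types (A : {group {perm U}}) (s : {perm U}).

(** Such [s] form the 2-closure of [A]. *)
Definition pairwise_in A s :=
  forall x y, x != y -> exists2 a, a \in A & a x = s x /\ a y = s y.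

Definition arc_orbit A (e : Defs.arc U) : {set Defs.arc U} :=
  [set arc_perm a e | a in A].

Lemma arc_orbit_refl A e : e \in arc_orbit A e.
Proof.
apply/imsetP; exists 1%g; first exact: group1.
by apply/val_inj; rewrite /= !perm1 -surjective_pairing.
Qed.

Lemma arc_perm_orbit A a e :
  a \in A -> arc_orbit A (arc_perm a e) = arc_orbit A e.
Proof.
move=> Aa; apply/setP=> f; apply/imsetP/imsetP=> -[b Ab ->].
  by exists (a * b)%g; rewrite ?groupM //; apply/val_inj; rewrite /= !permM.
exists (a^-1 * b)%g; rewrite ?groupM ?groupV //.
by apply/val_inj; rewrite /= !permM !permK.
Qed.

(** Automorphy is tested one arc at a time, so agreeing on each arc with some automorphism
    suffices. *)
Lemma DGR_pairwise A : DGR A <-> forall s, pairwise_in A s -> s \in A.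
Proof.
split=> [[C [E defA]] s sP | A2].
  rewrite defA inE; apply/forallP=> e.
  have [a Aa [a1 a2]] := sP _ _ (valP e).
  move: Aa; rewrite defA inE => /forallP/(_ e)/eqP <-.
  by apply/eqP; congr E; apply/val_inj; rewrite /= a1 a2.
exists {set Defs.arc U}, (arc_orbit A); apply/setP=> s; apply/idP/idP=> [As | ].
  by rewrite inE; apply/forallP=> e; rewrite arc_perm_orbit.
rewrite inE => /forallP sE; apply: A2 => x y xy.
pose e : Defs.arc U := exist (fun p : U * U => p.1 != p.2) (x, y) xy.
(* The color of an arc is an orbit containing it, and [s] preserves colors. *)
have: arc_perm s e \in arc_orbit A e by rewrite -(eqP (sE e)) arc_orbit_refl.
by case/imsetP=> a Aa [sx sy]; exists a.
Qed.

End TwoClosed.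

Arguments pairwise_in {U} A s.

Lemma pairwise_in_prod (V W : finType) (A : {group {perm V}})
    (B : {group {perm W}}) (s : {perm V}) :
  1 < #|V| -> pairwise_in A s ->
  pairwise_in (prod_perm_group A B) (prod_perm s 1).
Proof.
move=> V_gt1 sP [x y] [x' y'] _.
have [a Aa [ax ax']]: exists2 a, a \in A & a x = s x /\ a x' = s x'.
  have [<- | /sP //] := eqVneq x x'.
  have [z zx]: exists z, z != x.
    move: V_gt1; rewrite -cardsT (cardsD1 x) inE ltnS => /card_gt0P[z].
    by rewrite !inE andbT; exists z.
  by have [a Aa [_ ax]] := sP _ _ zx; exists a.
exists (prod_perm a 1); first by apply/imset2P; exists a 1%g.
by rewrite !permE /prod_act /= ax ax'.
Qed.

(** Covers the case where [pairwise_in_prod] has no second point of [V] to use. *)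
Lemma DGR_card_le1 (V : finType) (A : {group {perm V}}) : #|V| <= 1 -> DGR A.
Proof.
move=> /fintype_le1P V1; apply/DGR_pairwise=> s _.
suff -> : s = 1%g by exact: group1.
by apply/permP=> x; rewrite perm1; apply: V1.
Qed.

Theorem theorem3p3 (V W : finType)
    (A : {group {perm V}}) (B : {group {perm W}})
    (V_nonempty : 0 < #|V|) (W_nonempty : 0 < #|W|)
    (A_neq_I1 : ~ is_trivial_perm_group 1 A)
    (B_neq_I1 : ~ is_trivial_perm_group 1 B)
    (A_notin_DGR : ~ DGR A) :
  ~ DGR (prod_perm_group A B).
Proof.
move=> /DGR_pairwise AB2; apply: A_notin_DGR.
have [/DGR_card_le1 // | V_gt1] := leqP #|V| 1.
apply/DGR_pairwise=> s /(pairwise_in_prod _ _ _ B _ V_gt1)/AB2.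
(* Comparing first coordinates in [prod_perm s 1 = prod_perm a b] takes some point [w] of [W]. *)
case/imset2P=> a b Aa _ /permP eq_sa; case/card_gt0P: W_nonempty => w _.
suff -> : s = a by [].
by apply/permP=> x; have:= eq_sa (x, w); rewrite !permE => -[].
Qed.
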